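(* For $i\in\{1,2,3\}$ (with $\lambda\ge1$ if $i=3$) and $x\in\mathbb N_0$, the norm of the dual matrix valued orthogonal polynomial $Q_{x,i}^{(\lambda)}$, $$\mathcal W_{x,i}^{(\lambda)}=\sum_{n=0}^\infty Q_{x,i}^{(\lambda)}\bigl(\rho_i^{(\lambda)}(n)\bigr)^*U^{(\lambda)}(n)\,Q_{x,i}^{(\lambda)}\bigl(\rho_i^{(\lambda)}(n)\bigr),\qquad U^{(\lambda)}(n)=P_n^{(\lambda)}(0)^*(\mathcal H_n^{(\lambda)})^{-1}P_n^{(\lambda)}(0),$$ is given by $$\mathcal W_{x,i}^{(\lambda)}=\bigl(\Upsilon_i^{(\lambda)}(x)\,W^{(\lambda)}(x)\,\Upsilon_i^{(\lambda)}(x)^*\bigr)^{-1}.$$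
   Context: $N\ge1$, $a>0$, $\lambda\in\mathbb N_0=\{0,1,2,\dots\}$. $\mu_1,\dots,\mu_N>0$ satisfy $(\mu_j/\mu_k)^2=a^{k-j}\frac{(N-k)!}{(N-j)!}$ and $\delta_k^{(\lambda)}=(a/2)^\lambda\frac{(\lambda+k-1)!}{(k-1)!}$. $A$ is the $N\times N$ matrix whose only nonzero entries are $A_{k+1,k}=\mu_{k+1}/\mu_k=\sqrt{(N-k)/a}$, $1\le k\le N-1$; $J=\mathrm{diag}(1,\dots,N)$; $T^{(\lambda)}=\mathrm{diag}(\delta_1^{(\lambda)},\dots,\delta_N^{(\lambda)})$; $L_0$ is lower triangular with $(L_0)_{jk}=\frac{\mu_j}{\mu_k}\frac{(-a)^{j-k}}{(j-k)!}$ for $j\ge k$. $W^{(\lambda)}(x)=\frac{a^x}{x!}(I+A)^{x+\lambda}T^{(\lambda)}(I+A^* )^{x+\lambda}$, $x\in\mathbb N_0$; $P_n^{(\lambda)}$ are the monic matrix polynomials, $\deg P_n^{(\lambda)}=n$, orthogonal for $\langle P,Q\rangle^{(\lambda)}=\sum_{x=0}^\infty P(x)W^{(\lambda)}(x)Q(x)^*$; $\mathcal H_n^{(\lambda)}=\langle P_n^{(\lambda)},P_n^{(\lambda)}\rangle^{(\lambda)}$. The matrices $P_n^{(\lambda)}(0)$ are invertible. $\rho_1^{(\lambda)}(n)=P_n^{(\lambda)}(0)^{-1}\Gamma_n^{(\lambda)}P_n^{(\lambda)}(0)$ with $\Gamma_n^{(\lambda)}=a(I+A)-J-(n+\lambda)(I+A)^{-1}$;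 $\rho_2^{(\lambda)}(n)=nP_n^{(\lambda)}(0)^{-1}G_n^{(\lambda)}P_n^{(\lambda)}(0)$; $\rho_3^{(\lambda)}(n)=(n+1)P_n^{(\lambda)}(0)^{-1}G_{n+1}^{(\lambda-1)}P_n^{(\lambda)}(0)$, where $G_n^{(\lambda)}=\frac12L_0^{-1}(I+A)^{n+\lambda}((N+\lambda+1)I-J)(I+A)^{-n-\lambda}L_0$. $\Upsilon_1^{(\lambda)}(x)=a^{-x}(I+A)^{-x}$; $\Upsilon_2^{(\lambda)}(x)=\frac{(-2)^x}{a^x}(I+A)^\lambda(J(I+A^* )+\lambda I)^{-x}(I+A)^{-x-\lambda}$; $\Upsilon_3^{(\lambda)}(x)=\frac{(-2)^x}{a^x}(I+A)^\lambda(J(I+A^* )+(\lambda-1)I)^{-x}(I+A)^{-x-\lambda}$ ($\lambda\ge1$). $Q_{x,i}^{(\lambda)}$ is the unique monic matrix polynomial of degree $x$ (evaluated with the variable on the left, $Q(\mathcal N)=\sum_k\mathcal N^kA_k$) with $Q_{x,i}^{(\lambda)}(\rho_i^{(\lambda)}(n))=P_n^{(\lambda)}(0)^{-1}P_n^{(\lambda)}(x)\Upsilon_i^{(\lambda)}(x)^{-1}$ for all $n\in\mathbb N_0$. *)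

(* Defs.v *)
From HB Require Import structures.
From mathcomp Require Import all_boot all_order all_algebra.
From mathcomp Require Import complex.
From mathcomp Require Import all_classical all_reals all_analysis.

Set Implicit Arguments.
Unset Strict Implicit.
Unset Printing Implicit Defensive.

Import Order.TTheory GRing.Theory Num.Theory.
Import numFieldNormedType.Exports.

Local Open Scope classical_set_scope.
Local Open Scope ring_scope.
Local Open Scope sesquilinear_scope.

(* The index of the three families of dual polynomials. *)
Inductive dual_family := Dual1 | Dual2 | Dual3.

(* The matrix size is N = m.+1, so that square matrices form a nontrivial ring
   with inverses. Rows and columns are indexed by 'I_N from 0: the index k below
   is k + 1 in the usual 1-based numbering. The definitions are written for an
   abstract numClosedFieldType K because its topology is not found directly on
   R[i]; they are meant for K := R[i], R the reals. *)
Section MatrixCharlier.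
Variables (K : numClosedFieldType) (m : nat).
Local Notation N := m.+1.
Implicit Types (P Q : {poly 'M[K]_N}) (u : nat -> 'M[K]_N).

Definition has_sum u (S : 'M[K]_N) : Prop := series u @ \oo --> S.

Definition series_sum u : 'M[K]_N := limn (series u).

(* Horner evaluation with the variable on the left of the coefficients, whereas
   Q.[X] is \sum_k Q`_k * X ^+ k. *)
Definition lhorner Q (X : 'M[K]_N) : 'M[K]_N :=
  \sum_(k < size Q) X ^+ k * Q`_k.

Variables (a : K) (mu : 'I_N -> K) (lambda : nat).

Definition mu_relation : Prop := forall j k : 'I_N,
  (mu j / mu k) ^+ 2 =
  a ^ (k%:Z - j%:Z) * (N - k.+1)`!%:R / (N - j.+1)`!%:R.

Definition mxA : 'M[K]_N :=
  \matrix_(j, k) (if j == k.+1 :> nat then mu j / mu k else 0).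

Definition mxJ : 'M[K]_N := diag_mx (\row_k k.+1%:R).

(* With the 1-based index k + 1 this is
   (a/2)^lambda (lambda + (k+1) - 1)! / ((k+1) - 1)!. *)
Definition delta (k : 'I_N) : K :=
  (a / 2) ^+ lambda * (lambda + k)`!%:R / k`!%:R.

Definition mxT : 'M[K]_N := diag_mx (\row_k delta k).

Definition mxL0 : 'M[K]_N :=
  \matrix_(j, k)
    (if (k <= j)%N then mu j / mu k * ((- a) ^+ (j - k) / (j - k)`!%:R) else 0).

Definition weight (x : nat) : 'M[K]_N :=
  (a ^+ x / x`!%:R) *:
    ((1 + mxA) ^+ (x + lambda) * mxT * (1 + mxA^t* ) ^+ (x + lambda)).

(* For K := R[i] the series converges for all P and Q. The argument x%:R is a
   scalar matrix, so the side of the variable does not matter here. *)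
Definition inner P Q : 'M[K]_N :=
  series_sum (fun x => P.[x%:R] * weight x * (Q.[x%:R])^t* ).

Definition monic_orthogonal (P : nat -> {poly 'M[K]_N}) : Prop :=
  (forall n, P n \is monic /\ size (P n) = n.+1) /\
  (forall n k, n != k -> inner (P n) (P k) = 0).

Definition mxGamma (n : nat) : 'M[K]_N :=
  a *: (1 + mxA) - mxJ - (n + lambda)%:R *: (1 + mxA)^-1.

Definition mxG (lam n : nat) : 'M[K]_N :=
  2^-1 *: (mxL0^-1 * (1 + mxA) ^+ (n + lam) * ((N + lam + 1)%:R - mxJ)
             * (1 + mxA) ^- (n + lam) * mxL0).

Definition Upsilon (i : dual_family) (x : nat) : 'M[K]_N :=
  match i with
  | Dual1 => a ^- x *: (1 + mxA) ^- x
  | Dual2 => ((- 2) ^+ x / a ^+ x) *: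
      ((1 + mxA) ^+ lambda * (mxJ * (1 + mxA^t* ) + lambda%:R) ^- x
         * (1 + mxA) ^- (x + lambda))
  | Dual3 => ((- 2) ^+ x / a ^+ x) *:
      ((1 + mxA) ^+ lambda * (mxJ * (1 + mxA^t* ) + (lambda%:R - 1)) ^- x
         * (1 + mxA) ^- (x + lambda))
  end.

Variable P : nat -> {poly 'M[K]_N}.

Definition sqnorm (n : nat) : 'M[K]_N := inner (P n) (P n).

(* lambda.-1 in the third case is the true predecessor only for lambda > 0,
   which is required whenever that case is used. *)
Definition rho (i : dual_family) (n : nat) : 'M[K]_N :=
  let p := (P n).[0] in
  match i with
  | Dual1 => p^-1 * mxGamma n * p
  | Dual2 => n%:R *: (p^-1 * mxG lambda n * p)
  | Dual3 => n.+1%:R *: (p^-1 * mxG lambda.-1 n.+1 * p)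
  end.

Definition dual_weight (n : nat) : 'M[K]_N :=
  ((P n).[0])^t* * (sqnorm n)^-1 * (P n).[0].

Definition is_dual_poly (i : dual_family) (x : nat) Q : Prop :=
  [/\ Q \is monic, size Q = x.+1 &
      forall n, lhorner Q (rho i n) =
                ((P n).[0])^-1 * (P n).[x%:R] * (Upsilon i x)^-1].

Definition dual_norm_term (i : dual_family) Q (n : nat) : 'M[K]_N :=
  (lhorner Q (rho i n))^t* * dual_weight n * lhorner Q (rho i n).

End MatrixCharlier.

(* Main.v *)
Require Import Defs.
From HB Require Import structures.
From mathcomp Require Import all_boot all_order all_algebra.
From mathcomp Require Import complex.
From mathcomp Require Import all_classical all_reals all_analysis.
From mathcomp Require Import ring.
Set Implicit Arguments.
Unset Strict Implicit.
Unset Printing Implicit Defensive.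
Import Order.TTheory GRing.Theory Num.Theory.
Import numFieldNormedType.Exports.
Local Open Scope classical_set_scope.
Local Open Scope ring_scope.
Local Open Scope sesquilinear_scope.

(** Write W for the weight, p_n for the value P_n(0), H_n for the squared norm of
P_n and U for Upsilon_i(x). Since Q(rho_i(n)) = p_n^-1 P_n(x) U^-1, the factors
p_n cancel in the n-th term of the norm series, which becomes
  (U^-1)^* ( P_n(x)^* H_n^-1 P_n(x) ) U^-1.
So the three dual families have the same proof, and everything reduces to
  sum_n P_n(x)^* H_n^-1 P_n(x) = W(x)^-1                                     (K)
together with the invertibility of p_n, H_n, W(x) and U.

W(x) = V(x) V(x)^* / x! for an invertible V(x) whose entries grow at most
exponentially in x ([weight_gram]). Hence <F, G> = sum_x F(x) W(x) G(x)^* is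
defined for all matrix functions F, G of at most exponential growth, a class
that contains the polynomials and the finitely supported functions, and it is
definite. A polynomial P_n whose H_n kills a row c on the left has <c P_n, c P_n>
= 0, so c P_n = 0 and c = 0 ([sqnorm_unit]). If c P_n(0) = 0 then c P_n = r X
with r of degree below n, so 0 = <c P_n, r> = sum_x x r(x) W(x) r(x)^*, which
forces r = 0 at every x >= 1 and again c = 0 ([orth_horner0_unit]): the zeros of
det P_n stay away from the end point of the support.

(K) is Parseval's identity for the point mass E = delta_x I. The projection of E
on the span of P_0, ..., P_(n-1) leaves a residual F_n with
  <F_n, F_n> = W(x) - W(x) ( sum_(k < n) P_k(x)^* H_k^-1 P_k(x) ) W(x)
([pairing_residual]), so (K) says that E is a limit of polynomials
([kernel_has_sum]). The projection is at least as good as every polynomial of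
degree below n ([residual_minimal]), so it suffices to exhibit good scalar
polynomials ([point_approx]). They are
  q_l(t) = c(t) prod_(1 <= k <= l) (1 - (t - x) / k)
with c a fixed polynomial such that c(x) = 1 and c vanishes at 0, ..., x - 1: at a
point t = x + y + 1 the product is (-1)^l binom(y, l), which is at most
3^y / 2^l, and the factorial decay of W beats the exponential factors. *)

(** * Conjugate transposes and Gram matrices *)

Section ConjugateTranspose.
Variable K : numClosedFieldType.

Lemma adjmxM m n p (A : 'M[K]_(m, n)) (B : 'M[K]_(n, p)) :
  (A *m B)^t* = B^t* *m A^t*.
Proof. by rewrite trmx_mul map_mxM. Qed.

Lemma adjmxD m n (A B : 'M[K]_(m, n)) : (A + B)^t* = A^t* + B^t*.
Proof. by rewrite linearD map_mxD. Qed.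

Lemma adjmxN m n (A : 'M[K]_(m, n)) : (- A)^t* = - A^t*.
Proof. by rewrite linearN map_mxN. Qed.

Lemma adjmxB m n (A B : 'M[K]_(m, n)) : (A - B)^t* = A^t* - B^t*.
Proof. by rewrite adjmxD adjmxN. Qed.

Lemma adjmxZ m n c (A : 'M[K]_(m, n)) : (c *: A)^t* = c^* *: A^t*.
Proof. by rewrite linearZ map_mxZ. Qed.

Lemma adjmx_sum m n (I : Type) (r : seq I) (F : I -> 'M[K]_(m, n)) :
  (\sum_(k <- r) F k)^t* = \sum_(k <- r) (F k)^t*.
Proof. by rewrite linear_sum raddf_sum. Qed.

Lemma adjmxX n (A : 'M[K]_n.+1) k : (A ^+ k)^t* = (A^t* ) ^+ k.
Proof.
elim: k => [|k IHk]; first by rewrite !expr0 trmx1 map_mx1.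
by rewrite exprS exprSr adjmxM IHk.
Qed.

Lemma adjmxV n (A : 'M[K]_n.+1) : (A^-1)^t* = (A^t*)^-1.
Proof. by rewrite trmx_inv map_invmx. Qed.

Lemma adjmx_unit n (A : 'M[K]_n.+1) :
  (A^t* \is a GRing.unit) = (A \is a GRing.unit).
Proof. exact: etrans (map_unitmx _ _) (unitmx_tr _). Qed.

Lemma mulmx_adjE m n p (A : 'M[K]_(m, n)) (B : 'M[K]_(p, n)) i j :
  (A *m B^t* ) i j = \sum_k A i k * (B j k)^*.
Proof. by rewrite mxE; apply: eq_bigr => k _; rewrite !mxE. Qed.

Lemma gram_diagE m n (A : 'M[K]_(m, n)) i :
  (A *m A^t* ) i i = \sum_k `|A i k| ^+ 2.
Proof. by rewrite mulmx_adjE; apply: eq_bigr => k _; rewrite normCK. Qed.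

Lemma gram_diag_ge0 m n (A : 'M[K]_(m, n)) i : 0 <= (A *m A^t* ) i i.
Proof. by rewrite gram_diagE sumr_ge0 // => k _; rewrite exprn_ge0. Qed.

Lemma gram_diag_eq0 m n (A : 'M[K]_(m, n)) :
  (forall i, (A *m A^t* ) i i = 0) -> A = 0.
Proof.
move=> A0; apply/matrixP => i k; rewrite mxE; apply/eqP.
have /eqP := A0 i; rewrite gram_diagE psumr_eq0 => [|j _]; last by rewrite exprn_ge0.
by move=> /allP/(_ k (mem_index_enum _)); rewrite expf_eq0 /= normr_eq0.
Qed.

(** Convergence of a Gram matrix to 0 can thus be checked on its trace, a
nonnegative scalar: by the inequality 2 |u v| <= |u|^2 + |v|^2. *)
Lemma gram_norm_le_trace m n (A : 'M[K]_(m, n)) i j :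
  `|(A *m A^t* ) i j| <= \tr (A *m A^t* ).
Proof.
have sq_ge0 (I : finType) (f : I -> K) k : `|f k| ^+ 2 <= \sum_l `|f l| ^+ 2.
  by rewrite (bigD1 k) //= lerDl sumr_ge0 // => l _; rewrite exprn_ge0.
have le_tr k : (A *m A^t* ) k k <= \tr (A *m A^t* ).
  rewrite /mxtrace (bigD1 k) //= lerDl sumr_ge0 // => l _.
  exact: gram_diag_ge0.
rewrite mulmx_adjE; apply: le_trans (ler_norm_sum _ _ _) _.
rewrite -(ler_pM2l (x := 2)) //.
apply: (@le_trans _ _ ((A *m A^t* ) i i + (A *m A^t* ) j j)); last first.
  by rewrite mulr_natl mulr2n lerD.
rewrite !gram_diagE -big_split /= mulr_sumr; apply: ler_sum => k _.
rewrite normrM norm_conjC -subr_ge0.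
have -> : `|A i k| ^+ 2 + `|A j k| ^+ 2 - 2 * (`|A i k| * `|A j k|) =
          (`|A i k| - `|A j k|) ^+ 2 by rewrite sqrrB mulr_natl addrAC.
by apply: real_exprn_even_ge0 => //; rewrite rpredB ?normr_real.
Qed.

End ConjugateTranspose.

(** * Limits and sums of matrix sequences *)

Lemma cvg_sumn (K : numFieldType) (V : normedModType K) (I : Type) (r : seq I)
    (f : I -> nat -> V) (l : I -> V) :
  (forall k, f k @ \oo --> l k) ->
  (fun n => \sum_(k <- r) f k n) @ \oo --> \sum_(k <- r) l k.
Proof.
move=> fl; elim: r => [|k r IHr].
  rewrite big_nil (_ : (fun n => _) = fun=> 0); first exact: cvg_cst.
  by apply/funext => n; rewrite big_nil.
rewrite big_cons (_ : (fun n => _) = f k \+ (fun n => \sum_(k <- r) f k n)).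
  exact: cvgD.
by apply/funext => n; rewrite big_cons.
Qed.

Lemma cvgn_ext (T : topologicalType) (u v : nat -> T) (l : T) :
  u =1 v -> u @ \oo --> l -> v @ \oo --> l.
Proof. by move=> /funext ->. Qed.

(** A nonnegative number is its own norm, and the norm is continuous. This makes
order arguments available in a field that is only partially ordered. *)
Lemma cvgn_ge0 (K : numFieldType) (u : nat -> K) (l : K) :
  u @ \oo --> l -> (forall n, 0 <= u n) -> 0 <= l.
Proof.
move=> ul u0; have -> : l = `|l|; last exact: normr_ge0.
apply: (@cvg_unique _ (@norm_hausdorff _ K^o) (u @ \oo) _ _ _ ul).
rewrite [u in u @ _](_ : u = fun n => `|u n|); first exact: cvg_norm.
by apply/funext => n; rewrite ger0_norm.
Qed.

Section EntrywiseLimits.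
Variables (K : numClosedFieldType) (m : nat).
Local Notation N := m.+1.
Implicit Types (u v : nat -> 'M[K]_N) (S T C : 'M[K]_N).

Lemma cvg_mxP u S :
  (u @ \oo --> S) <-> forall i j, (fun n => u n i j) @ \oo --> S i j.
Proof.
split=> [uS i j|uS].
  exact: (cvg_comp _ _ uS (@coord_continuous K N N i j S)).
have delta_sum (M : 'M[K]_N) : M = \sum_i \sum_j M i j *: delta_mx i j.
  exact: matrix_sum_delta.
rewrite [S]delta_sum (_ : u = fun n => \sum_i \sum_j u n i j *: delta_mx i j);
  last by apply/funext => n; rewrite -delta_sum.
apply: cvg_sumn => i; apply: cvg_sumn => j.
exact: cvgZr_tmp (uS i j).
Qed.

Lemma cvg_mx_mull C u S :
  u @ \oo --> S -> (fun n => C * u n) @ \oo --> C * S.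
Proof.
move=> /cvg_mxP uS; apply/cvg_mxP => i j; rewrite mxE.
rewrite (_ : (fun n => _) = fun n => \sum_k C i k * u n k j); last first.
  by apply/funext => n; rewrite mxE.
by apply: cvg_sumn => k; apply: cvgMl_tmp.
Qed.

Lemma cvg_mx_adj u S : u @ \oo --> S -> (fun n => (u n)^t* ) @ \oo --> S^t*.
Proof.
move=> /cvg_mxP uS; apply/cvg_mxP => i j; rewrite !mxE.
rewrite (_ : (fun n => _) = fun n => (u n j i)^*); last first.
  by apply/funext => n; rewrite !mxE.
apply/cvgrPdist_lt => e e0; have /cvgrPdist_lt/(_ e e0) := uS j i.
by apply: filterS => n; rewrite -rmorphB norm_conjC.
Qed.

Lemma cvg_mx_mulr C u S :
  u @ \oo --> S -> (fun n => u n * C) @ \oo --> S * C.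
Proof.
move=> /cvg_mx_adj /(cvg_mx_mull (C := C^t* )) /cvg_mx_adj.
by rewrite adjmxM !trmxCK; apply: cvgn_ext => n;
  rewrite adjmxM !trmxCK.
Qed.

Lemma cvg_mxtrace u S : u @ \oo --> S -> (fun n => \tr (u n)) @ \oo --> \tr S.
Proof. by move=> /cvg_mxP uS; apply: cvg_sumn => i; apply: uS. Qed.

Lemma has_sum_unique u S T : has_sum u S -> has_sum u T -> S = T.
Proof. exact: cvg_unique. Qed.

Lemma has_sumD u v S T :
  has_sum u S -> has_sum v T -> has_sum (fun x => u x + v x) (S + T).
Proof.
by move=> uS vT; rewrite /has_sum -[X in series X]/(u + v) seriesD; exact: cvgD.
Qed.

Lemma has_sum_mull C u S : has_sum u S -> has_sum (fun x => C * u x) (C * S).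
Proof.
move=> /(cvg_mx_mull (C := C)); apply: cvgn_ext => n.
by rewrite /series /= mulr_sumr.
Qed.

Lemma has_sum_mulr C u S : has_sum u S -> has_sum (fun x => u x * C) (S * C).
Proof.
move=> /(cvg_mx_mulr (C := C)); apply: cvgn_ext => n.
by rewrite /series /= mulr_suml.
Qed.

Lemma has_sum_adj u S : has_sum u S -> has_sum (fun x => (u x)^t* ) (S^t* ).
Proof.
move=> /cvg_mx_adj; apply: cvgn_ext => n.
by rewrite /series /= adjmx_sum.
Qed.

Lemma has_sum_single u x0 : (forall x, x != x0 -> u x = 0) -> has_sum u (u x0).
Proof.
move=> u0; apply: cvg_near_cst; exists x0.+1 => // n /= lt_x0n.
rewrite /series /= (bigD1_seq x0) ?mem_index_iota ?iota_uniq //=.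
by rewrite big1 ?addr0 // => x; apply: u0.
Qed.

Lemma has_sum_coord u S i j :
  has_sum u S -> series (fun x => u x i j) @ \oo --> S i j.
Proof.
move=> /cvg_mxP/(_ i j); apply: cvgn_ext => n.
by rewrite /series /= summxE.
Qed.

Lemma has_sum_trace u S :
  has_sum u S -> series (fun x => \tr (u x)) @ \oo --> \tr S.
Proof.
move=> /cvg_mxtrace; apply: cvgn_ext => n.
by rewrite /series /= raddf_sum.
Qed.

Lemma has_sum_diag_ge0 u S i :
  has_sum u S -> (forall x, 0 <= u x i i) -> 0 <= S i i.
Proof.
by move=> /(has_sum_coord (i := i) (j := i)) uS u0; apply: cvgn_ge0 uS _ => n;
  apply: sumr_ge0.
Qed.

(** Replacing the term at x by 0 keeps all terms nonnegative and changes the sum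
to minus that term. *)
Lemma has_sum0_diag_eq0 u i :
  has_sum u 0 -> (forall x, 0 <= u x i i) -> forall x, u x i i = 0.
Proof.
move=> u_0 u_ge0 x; apply/eqP; rewrite eq_le u_ge0 andbT -oppr_ge0.
pose v y := (y == x)%:R *: u x; have vx : has_sum v (v x).
  by apply: has_sum_single => y /negPf yx; rewrite /v yx scale0r.
have := has_sumD u_0 (has_sum_mull (C := -1) vx).
move=> /(has_sum_diag_ge0 (i := i)); rewrite add0r /v eqxx scale1r mulN1r mxE.
apply=> y; rewrite mulN1r !mxE; case: eqP => [->|_]; first by rewrite mul1r subrr.
by rewrite mul0r subr0.
Qed.

End EntrywiseLimits.

(** * Series dominated by an exponential series *)

(** The only completeness property of the scalars that the argument uses. It is
isolated as a predicate because the topology is attached to an abstract K. *)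
Definition exp_summable (K : numClosedFieldType) : Prop :=
  forall (u : nat -> K) (C c : K), 0 <= C -> 0 <= c ->
  (forall n, `|u n| <= C * (c ^+ n / n`!%:R)) -> cvgn (series u).

Lemma cvg_isometry (R K : numFieldType) (f : {additive R -> K})
    (f_norm : forall r, `|f r| = f `|r|)
    (f_lt : forall r s, r < s -> f r < f s)
    (f_dense : forall e : K, 0 < e -> exists2 d : R, 0 < d & f d = e)
    (u : nat -> R) (l : R) :
  u @ \oo --> l -> (fun n => f (u n)) @ \oo --> f l.
Proof.
move=> /cvgrPdist_lt ul; apply/cvgrPdist_lt => e /f_dense [d /ul nb <-].
by apply: filterS nb => n; rewrite -raddfB f_norm => /f_lt.
Qed.

Lemma exp_dominated_real_cvg (R : realType) (u : nat -> R) (C c : R) :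
  0 <= C -> 0 <= c -> (forall n, `|u n| <= C * (c ^+ n / n`!%:R)) ->
  cvgn (series u).
Proof.
move=> C0 c0 u_le; apply: normed_cvg.
have e_ge0 n : 0 <= c ^+ n / n`!%:R by rewrite divr_ge0 ?exprn_ge0 ?ler0n.
apply: (@series_le_cvg _ _ (C *: exp_coeff c)) => [n|n|n|].
- exact: normr_ge0.
- by have := mulr_ge0 C0 (e_ge0 n).
- exact: u_le.
- exact/is_cvg_seriesZ/is_cvg_series_exp_coeff.
Qed.

(** The real and imaginary parts of a dominated series are dominated real series,
and j is to be thought of as the imaginary unit. *)
Lemma exp_summable_real_parts (R : realType) (K : numClosedFieldType)
    (f : {rmorphism R -> K}) (re im : K -> R) (j : K) :
  {mono f : r s / r <= s} -> {mono f : r s / r < s} ->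
  (forall r, `|f r| = f `|r|) -> (forall z, 0 <= z -> f (re z) = z) ->
  (forall z, f `|re z| <= `|z|) -> (forall z, f `|im z| <= `|z|) ->
  (forall z, z = f (re z) + j * f (im z)) -> exp_summable K.
Proof.
move=> f_le f_lt f_norm f_re re_le im_le reimE u C c C0 c0 u_le.
have f_pos (e : K) : 0 < e -> exists2 d : R, 0 < d & f d = e.
  by move=> e0; exists (re e); rewrite ?f_re ?(ltW e0) // -f_lt rmorph0 f_re // ltW.
have part_cvg (g : K -> R) : (forall z, f `|g z| <= `|z|) -> cvgn (series (g \o u)).
  move=> g_le; apply: (@exp_dominated_real_cvg _ _ (re C) (re c)).
  - by rewrite -f_le rmorph0 f_re.
  - by rewrite -f_le rmorph0 f_re.
  move=> n; rewrite -f_le; apply: le_trans (g_le _) (le_trans (u_le n) _).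
  by rewrite rmorphM fmorph_div rmorphXn rmorph_nat /= !f_re.
have /cvg_ex [l1 ul1] := part_cvg re re_le.
have /cvg_ex [l2 ul2] := part_cvg im im_le.
have f_ltW r s : r < s -> f r < f s by rewrite f_lt.
apply/cvg_ex; exists (f l1 + j * f l2).
have -> : series u = (fun n => f (series (re \o u) n)) \+
                     (fun n => j * f (series (im \o u) n)).
  apply/funext => n; rewrite /series /= !raddf_sum mulr_sumr -big_split /=.
  by apply: eq_bigr => k _; rewrite -reimE.
exact: cvgD (cvg_isometry f_norm f_ltW f_pos ul1)
  (cvgMl_tmp (a := j) (cvg_isometry f_norm f_ltW f_pos ul2)).
Qed.

Lemma complex_exp_summable (R : realType) : exp_summable R[i].
Proof.
have sqr_le (x y : R) : `|x| <= Num.sqrt (x ^+ 2 + y ^+ 2).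
  by rewrite -sqrtr_sqr ler_wsqrtr // lerDl sqr_ge0.
apply: (@exp_summable_real_parts R R[i] (real_complex R) (@complex.Re R)
          (@complex.Im R) 'i%C).
- exact: lecR.
- exact: ltcR.
- by move=> r; rewrite normc_def /= expr0n /= addr0 sqrtr_sqr.
- by move=> z z0; exact: RRe_real (ger0_real z0).
- by move=> z; rewrite normc_def lecR.
- by move=> z; rewrite normc_def lecR addrC.
- exact: complexE.
Qed.

(** * Matrix functions of at most exponential growth *)

Section ExpBounded.
Variables (K : numClosedFieldType) (m : nat).
Local Notation N := m.+1.
Implicit Types (F G : nat -> 'M[K]_N) (p : {poly 'M[K]_N}).

(** Entrywise bounds with unspecified constants: the class is stable under sums,
products and conjugate transposes, without any matrix norm. *)
Definition exp_bounded F := exists C c : K,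
  [/\ 0 <= C, 0 <= c & forall x i j, `|F x i j| <= C * c ^+ x].

Lemma exp_boundedD F G :
  exp_bounded F -> exp_bounded G -> exp_bounded (fun x => F x + G x).
Proof.
move=> [C [c [C0 c0 Fle]]] [D [d [D0 d0 Gle]]].
exists (C + D), (c + d); split=> [||x i j]; rewrite ?addr_ge0 // mxE.
apply: le_trans (ler_normD _ _) _; rewrite mulrDl; apply: lerD.
  apply: le_trans (Fle x i j) _; apply: ler_wpM2l => //.
  by rewrite lerXn2r ?nnegrE ?addr_ge0 // lerDl.
apply: le_trans (Gle x i j) _; apply: ler_wpM2l => //.
by rewrite lerXn2r ?nnegrE ?addr_ge0 // lerDr.
Qed.

Lemma exp_boundedM F G :
  exp_bounded F -> exp_bounded G -> exp_bounded (fun x => F x * G x).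
Proof.
move=> [C [c [C0 c0 Fle]]] [D [d [D0 d0 Gle]]].
exists (C * D * N%:R), (c * d); split=> [||x i j]; rewrite ?mulr_ge0 ?ler0n // mxE.
apply: le_trans (ler_norm_sum _ _ _) _.
apply: (@le_trans _ _ (\sum_(k < N) (C * c ^+ x) * (D * d ^+ x))).
  by apply: ler_sum => k _; rewrite normrM ler_pM.
by rewrite sumr_const card_ord -[leLHS]mulr_natr exprMn mulrACA [leLHS]mulrAC.
Qed.

Lemma exp_bounded_adj F : exp_bounded F -> exp_bounded (fun x => (F x)^t* ).
Proof.
move=> [C [c [C0 c0 Fle]]]; exists C, c; split=> // x i j.
by rewrite !mxE norm_conjC.
Qed.

Lemma exp_bounded_bounded F (B : K) :
  (forall x i j, `|F x i j| <= B) -> exp_bounded F.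
Proof.
move=> Fle; exists B, 1; split=> [||x i j]; rewrite ?ler01 //.
  exact: le_trans (Fle 0 ord0 ord0).
by rewrite expr1n mulr1.
Qed.

Lemma exp_bounded_cst (A : 'M[K]_N) : exp_bounded (fun=> A).
Proof.
apply: (@exp_bounded_bounded _ (\sum_i \sum_j `|A i j|)) => x i j.
rewrite (bigD1 i) //= (bigD1 j) //= -addrA lerDl addr_ge0 //.
  by rewrite sumr_ge0.
by rewrite sumr_ge0 // => k _; rewrite sumr_ge0.
Qed.

Lemma exp_boundedX (A : 'M[K]_N) : exp_bounded (fun x => A ^+ x).
Proof.
have [B [B0 Ale]] : exists B : K, 0 <= B /\ forall i j, `|A i j| <= B.
  have [C [c [C0 c0 Ale]]] := exp_bounded_cst A.
  by exists C; split => // i j; have := Ale 0 i j; rewrite expr0 mulr1.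
exists 1, (B * N%:R); split=> [||x]; rewrite ?ler01 ?mulr_ge0 ?ler0n //.
elim: x => [|x IHx] i j.
  by rewrite !expr0 mulr1 !mxE; case: eqP => _; rewrite ?normr1 ?normr0 ?ler01.
rewrite exprS mxE; apply: le_trans (ler_norm_sum _ _ _) _.
apply: (@le_trans _ _ (\sum_(k < N) B * (B * N%:R) ^+ x)).
  by apply: ler_sum => k _; rewrite normrM ler_pM // -[leRHS]mul1r.
by rewrite sumr_const card_ord -[leLHS]mulr_natr mul1r exprS mulrAC.
Qed.

Lemma exp_bounded_nat : exp_bounded (fun x => x%:R).
Proof.
exists 1, 2; split=> [||x i j]; rewrite ?ler01 ?ler0n //.
rewrite mul1r -[x%:R in leLHS](rmorph_nat (@scalar_mx K N)) mxE.
apply: (@le_trans _ _ x%:R).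
  by case: eqP => _; rewrite ?mulr1n ?mulr0n ?normr0 ?ler0n // normr_nat.
by rewrite -natrX ler_nat ltnW // ltn_expl.
Qed.

Lemma exp_bounded_horner p : exp_bounded (fun x => p.[x%:R]).
Proof.
elim/poly_ind: p => [|p c IHp].
  rewrite (_ : (fun x => _) = fun=> 0); first exact: exp_bounded_cst.
  by apply/funext => x; rewrite horner0.
rewrite (_ : (fun x => _) = fun x => p.[x%:R] * x%:R + c); last first.
  by apply/funext => x; rewrite hornerMXaddC.
apply: exp_boundedD; last exact: exp_bounded_cst.
by apply: exp_boundedM => //; exact: exp_bounded_nat.
Qed.

Lemma exp_boundedB F G :
  exp_bounded F -> exp_bounded G -> exp_bounded (fun x => F x - G x).
Proof.
move=> Fb Gb; have := exp_boundedD Fb (exp_boundedM (exp_bounded_cst (-1)) Gb).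
by congr exp_bounded; apply/funext => x; rewrite mulN1r.
Qed.

Lemma exp_bounded_trace F : exp_bounded F -> exists C c : K,
  [/\ 0 <= C, 0 <= c & forall x, `|\tr (F x)| <= C * c ^+ x].
Proof.
move=> [C [c [C0 c0 Fle]]]; exists (C * N%:R), c; split=> [||x] //.
  by rewrite mulr_ge0 ?ler0n.
apply: le_trans (ler_norm_sum _ _ _) _.
apply: (@le_trans _ _ (\sum_(k < N) (C * c ^+ x))); first exact: ler_sum.
by rewrite sumr_const card_ord -[leLHS]mulr_natr mulrAC.
Qed.

End ExpBounded.

(** * Zeros of matrix polynomials *)

Section MatrixPolynomials.
Variables (K : numClosedFieldType) (m : nat).
Local Notation N := m.+1.
Implicit Types p : {poly 'M[K]_N}.

Lemma natr_mx_unit k : (k.+1%:R : 'M[K]_N) \is a GRing.unit.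
Proof.
rewrite -(rmorph_nat (@scalar_mx K N)) rmorph_unit // unitfE.
by rewrite pnatr_eq0.
Qed.

(** The coefficient ring is not commutative, but the scalar matrices 1, 2, ...
commute and have invertible differences, so a nonzero polynomial still has at
most as many of them as roots as its degree. The point 0 is left out because the
argument for the invertibility of P_n(0) gives no information there. *)
Lemma poly_eq0_of_nat p : (forall x, (0 < x)%N -> p.[x%:R] = 0) -> p = 0.
Proof.
move=> p0; apply/eqP/negPn/negP => /max_ring_poly_roots.
pose rs : seq 'M[K]_N := [seq k.+1%:R | k <- iota 0 (size p)].
move=> /(_ rs); rewrite size_map size_iota ltnn => contra.
suff: false by []. apply: contra => /=.
  by apply/allP => y /mapP[k _ ->]; rewrite /root p0.
suff H s n : uniq_roots [seq (k.+1%:R : 'M[K]_N) | k <- iota s n] by exact: H.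
elim: n s => //= n IHn s; rewrite IHn andbT; apply/allP => y /mapP[k].
rewrite mem_iota => /andP[lt_sk _] ->{y}; rewrite /diff_roots.
rewrite -!natrM mulnC eqxx /= -natrB; last by rewrite ltnS ltnW.
by rewrite -(subnSK (m := s.+1)) // natr_mx_unit.
Qed.

End MatrixPolynomials.

(** * The matrix valued inner product of a factorized weight *)

Section WeightedPairing.
Variables (K : numClosedFieldType) (m : nat).
Local Notation N := m.+1.
Implicit Types (F G : nat -> 'M[K]_N) (p q : {poly 'M[K]_N}).

Hypothesis K_summable : exp_summable K.
Variable V : nat -> 'M[K]_N.
Hypothesis V_bounded : exp_bounded V.
Hypothesis V_unit : forall x, V x \is a GRing.unit.

Definition gram_weight (x : nat) : 'M[K]_N := x`!%:R^-1 *: (V x * (V x)^t* ).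

Local Notation W := gram_weight.

Definition pairing_term F G (x : nat) : 'M[K]_N := F x * W x * (G x)^t*.
Definition pairing F G : 'M[K]_N := series_sum (pairing_term F G).

Lemma pairing_termE F G x :
  pairing_term F G x = x`!%:R^-1 *: (F x * V x * (G x * V x)^t* ).
Proof. by rewrite /pairing_term -scalerAr -scalerAl adjmxM !mulrA. Qed.

Lemma gram_weight_adj x : (W x)^t* = W x.
Proof.
by rewrite /gram_weight adjmxZ fmorphV rmorph_nat adjmxM trmxCK.
Qed.

Lemma gram_weight_unit x : W x \is a GRing.unit.
Proof.
rewrite /gram_weight scaler_unit ?unitfE ?invr_eq0 ?pnatr_eq0 -?lt0n ?fact_gt0 //.
by rewrite unitrMl // adjmx_unit.
Qed.

Lemma pairing_term_adj F G x : (pairing_term F G x)^t* = pairing_term G F x.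
Proof. by rewrite /pairing_term !adjmxM trmxCK gram_weight_adj mulmxA. Qed.

(** The factor 1 / x! of the weight makes the series converge for all F and G of
at most exponential growth. *)
Lemma has_sum_pairing F G : exp_bounded F -> exp_bounded G ->
  has_sum (pairing_term F G) (pairing F G).
Proof.
move=> Fb Gb.
have [C [c [C0 c0 FGle]]] : exp_bounded (fun x => F x * V x * (G x * V x)^t* ).
  by apply: exp_boundedM; [|apply: exp_bounded_adj]; apply: exp_boundedM.
suff [S FGS] : exists S, has_sum (pairing_term F G) S.
  by rewrite /pairing /series_sum (cvg_lim _ FGS) //; exact: norm_hausdorff.
pose u i j x := pairing_term F G x i j.
exists (\matrix_(i, j) limn (series (u i j))); apply/cvg_mxP => i j.
rewrite mxE; have -> : (fun n => series (pairing_term F G) n i j) = series (u i j).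
  by apply/funext => n; rewrite /series /= summxE.
apply: (K_summable (C := C) (c := c)) => // x.
rewrite /u pairing_termE mxE normrM normfV normr_nat mulrA mulrC.
by rewrite ler_wpM2r ?invr_ge0 ?ler0n.
Qed.

Lemma pairingDl F F' G : exp_bounded F -> exp_bounded F' -> exp_bounded G ->
  pairing (fun x => F x + F' x) G = pairing F G + pairing F' G.
Proof.
move=> Fb Fb' Gb; apply: (has_sum_unique (u := pairing_term (fun x => F x + F' x) G)).
  by apply: has_sum_pairing => //; exact: exp_boundedD.
have := has_sumD (has_sum_pairing Fb Gb) (has_sum_pairing Fb' Gb).
by apply: cvgn_ext => n; apply: eq_bigr => x _; rewrite /pairing_term !mulrDl.
Qed.

Lemma pairingMl A F G : exp_bounded F -> exp_bounded G ->
  pairing (fun x => A * F x) G = A * pairing F G.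
Proof.
move=> Fb Gb; apply: (has_sum_unique (u := pairing_term (fun x => A * F x) G)).
  by apply: has_sum_pairing => //; apply: exp_boundedM => //; exact: exp_bounded_cst.
have := has_sum_mull (C := A) (has_sum_pairing Fb Gb).
by apply: cvgn_ext => n; apply: eq_bigr => x _; rewrite /pairing_term !mulrA.
Qed.

Lemma pairing_adj F G : exp_bounded F -> exp_bounded G ->
  (pairing F G)^t* = pairing G F.
Proof.
move=> Fb Gb; apply: (has_sum_unique (u := pairing_term G F)); last first.
  exact: has_sum_pairing.
have := has_sum_adj (has_sum_pairing Fb Gb).
by apply: cvgn_ext => n; apply: eq_bigr => x _; rewrite pairing_term_adj.
Qed.

Lemma pairingDr F G G' : exp_bounded F -> exp_bounded G -> exp_bounded G' ->
  pairing F (fun x => G x + G' x) = pairing F G + pairing F G'.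
Proof.
move=> Fb Gb Gb'; have GGb := exp_boundedD Gb Gb'.
by rewrite -pairing_adj // pairingDl // adjmxD !pairing_adj.
Qed.

Lemma pairingMr A F G : exp_bounded F -> exp_bounded G ->
  pairing F (fun x => A * G x) = pairing F G * A^t*.
Proof.
move=> Fb Gb; have AGb := exp_boundedM (exp_bounded_cst A) Gb.
by rewrite -pairing_adj // pairingMl // adjmxM pairing_adj.
Qed.

Lemma pairingBl F F' G : exp_bounded F -> exp_bounded F' -> exp_bounded G ->
  pairing (fun x => F x - F' x) G = pairing F G - pairing F' G.
Proof.
move=> Fb Fb' Gb; have NFb' := exp_boundedM (exp_bounded_cst (-1)) Fb'.
rewrite -mulN1r -pairingMl // -pairingDl //; congr pairing.
by apply/funext => x; rewrite mulN1r.
Qed.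

Lemma pairingBr F G G' : exp_bounded F -> exp_bounded G -> exp_bounded G' ->
  pairing F (fun x => G x - G' x) = pairing F G - pairing F G'.
Proof.
move=> Fb Gb Gb'; have GGb := exp_boundedB Gb Gb'.
by rewrite -pairing_adj // pairingBl // adjmxB !pairing_adj.
Qed.

Lemma pairing_pythagoras F G : exp_bounded F -> exp_bounded G ->
  pairing F G = 0 ->
  pairing (fun x => F x + G x) (fun x => F x + G x) = pairing F F + pairing G G.
Proof.
move=> Fb Gb FG0; have FGb := exp_boundedD Fb Gb.
rewrite pairingDl // !pairingDr // -(pairing_adj Fb Gb) FG0.
by rewrite linear0 map_mx0 addr0 add0r.
Qed.

Lemma pairing_term_diag_ge0 F x i : 0 <= pairing_term F F x i i.
Proof.
by rewrite pairing_termE mxE mulr_ge0 ?invr_ge0 ?ler0n //; exact: gram_diag_ge0.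
Qed.

Lemma pairing_term_diag_eq0 F x : (forall i, pairing_term F F x i i = 0) -> F x = 0.
Proof.
move=> Fx0; suff FV0 : F x * V x = 0 by rewrite -(mulrK (V_unit x) (F x)) FV0 mul0r.
apply: gram_diag_eq0 => i; have /eqP := Fx0 i.
by rewrite pairing_termE mxE mulf_eq0 invr_eq0 pnatr_eq0 -leqn0 leqNgt fact_gt0 => /eqP.
Qed.

Lemma pairing_definite F : exp_bounded F -> pairing F F = 0 -> forall x, F x = 0.
Proof.
move=> Fb F0 x; apply: pairing_term_diag_eq0 => i.
have := has_sum_pairing Fb Fb; rewrite F0 => /has_sum0_diag_eq0; apply=> y.
exact: pairing_term_diag_ge0.
Qed.

(** Each partial sum of the series of F W F^* is a sum of Gram matrices, so the
bound passes to the limit. *)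
Lemma pairing_norm_le_trace F i j : exp_bounded F ->
  `|pairing F F i j| <= \tr (pairing F F).
Proof.
move=> Fb; have FF := has_sum_pairing Fb Fb.
rewrite -subr_ge0; pose d x := pairing_term F F x i j.
have FFd : (fun n => series (fun x => \tr (pairing_term F F x)) n - `|series d n|)
    @ \oo --> \tr (pairing F F) - `|pairing F F i j|.
  apply: cvgB; first exact: has_sum_trace.
  by apply: cvg_norm; exact: has_sum_coord.
apply: cvgn_ge0 FFd _ => n; rewrite /d.
rewrite subr_ge0 /series /=; apply: le_trans (ler_norm_sum _ _ _) _.
apply: ler_sum => x _; rewrite pairing_termE mxE linearZ /= normrM normfV normr_nat.
by rewrite ler_wpM2l ?invr_ge0 ?ler0n //; exact: gram_norm_le_trace.
Qed.

Lemma pairing_trace_ge0 F : exp_bounded F -> 0 <= \tr (pairing F F).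
Proof. by move=> Fb; exact: le_trans (pairing_norm_le_trace ord0 ord0 Fb). Qed.

End WeightedPairing.

(** * Polynomial approximation of a point mass *)

(** One term of the binomial expansion of (1 + 2) ^ y. *)
Lemma bin_mul_pow2_le y n : ('C(y, n) * 2 ^ n <= 3 ^ y)%N.
Proof.
elim: y n => [|y IHy] [|n]; rewrite ?bin0 ?mul1n ?expn_gt0 //.
rewrite binS mulnDl [leqRHS]expnS mulSn leq_add //.
by rewrite expnS mulnCA leq_mul2l IHy.
Qed.

(** The polynomial prod_(1 <= k <= n) (1 - t / k) is 1 at t = 0, and at a positive
integer t it is, up to sign, a binomial coefficient. *)
Lemma prod_one_sub_div (K : numFieldType) y n :
  \prod_(k < n) (1 - y.+1%:R / k.+1%:R) = (-1) ^+ n * 'C(y, n)%:R :> K.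
Proof.
elim: n => [|n IHn]; first by rewrite big_ord0 expr0 bin0 mulr1.
have n1 : n.+1%:R != 0 :> K by rewrite pnatr_eq0.
have binE : 'C(y, n)%:R * (n.+1%:R - y.+1%:R) = - ('C(y, n.+1)%:R * n.+1%:R) :> K.
  rewrite -natrM [(_ * n.+1)%N]mulnC mul_bin_left natrM.
  have [le_ny|lt_yn] := leqP n y; last by rewrite bin_small // mulr0 mul0r oppr0.
  by rewrite mulrC -mulNr natrB // opprB -2!natr1 opprD addrACA subrr addr0.
rewrite big_ord_recr /= IHn exprS mulN1r mulNr -[X in _ * (X - _)](mulfV n1) -mulrBl.
by rewrite mulrA -[_ * _ * (_ - _)]mulrA binE mulrN mulNr mulrA mulfK.
Qed.

Section PointApproximation.
Variable K : numClosedFieldType.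

Lemma exp_bound_horner (p : {poly K}) : exists C c : K,
  [/\ 0 <= C, 0 <= c & forall x, `|p.[x%:R]| <= C * c ^+ x].
Proof.
have [C [c [C0 c0 ple]]] :=
  @exp_bounded_horner K 0 (map_poly (@scalar_mx K 1) p).
exists C, c; split=> // x; have := ple x ord0 ord0.
by rewrite -(rmorph_nat (@scalar_mx K 1)) horner_map /= mxE eqxx.
Qed.

(** A uniformly small constant 1 / n! multiplies a fixed exponential C c^x. The
product in [prod_one_sub_div], shifted to x0, is a good approximation to the
right of x0 only; the factor r kills the finitely many points to the left. *)
Lemma point_approx (x0 : nat) : exists C c : K, [/\ 0 <= C, 0 <= c &
  forall n, exists q : {poly K}, forall x,
    `|(x == x0)%:R - q.[x%:R]| <= C * c ^+ x / n`!%:R].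
Proof.
pose p : {poly K} := \prod_(j < x0) ('X - j%:R%:P).
have p_lt x : (x < x0)%N -> p.[x%:R] = 0.
  move=> lt_x; rewrite horner_prod (bigD1 (Ordinal lt_x)) //=.
  by rewrite hornerXsubC subrr mul0r.
have p_x0 : p.[x0%:R] != 0.
  rewrite horner_prod; apply/prodf_neq0 => j _.
  by rewrite hornerXsubC subr_eq0 eqr_nat gtn_eqF.
pose r := p.[x0%:R]^-1 *: p.
have [C [c [C0 c0 r_le]]] := exp_bound_horner r.
exists C, (c * 3); split; rewrite ?mulr_ge0 ?ler0n // => n.
(* With n! factors, the product at x > x0 is at most 3^x / 2^(n!), and
   2^(n!) >= n!. *)
exists (r * \prod_(k < n`!) (1 - k.+1%:R^-1 *: ('X - x0%:R%:P))) => x.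
rewrite hornerM horner_prod.
under eq_bigr do rewrite !hornerE.
have rhs_ge0 y : 0 <= C * (c * 3) ^+ y / n`!%:R.
  by rewrite divr_ge0 ?mulr_ge0 ?exprn_ge0 ?mulr_ge0 ?ler0n.
case: (ltngtP x x0) => [lt_x|gt_x|->].
- by rewrite hornerZ (p_lt x) // mulr0 mul0r subrr normr0.
- have [y Dx] : exists y, x = (x0 + y.+1)%N.
    by exists (x - x0.+1)%N; rewrite addnS -addSn subnKC.
  have -> : \prod_(k < n`!) (1 - k.+1%:R^-1 * (x%:R - x0%:R)) =
            \prod_(k < n`!) (1 - y.+1%:R / k.+1%:R) :> K.
    apply: eq_bigr => k _; congr (1 - _); rewrite mulrC Dx natrD.
    by rewrite [x0%:R + _]addrC addrK.
  rewrite prod_one_sub_div sub0r normrN !normrM normrX normrN1 expr1n mul1r.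
  rewrite exprMn -!mulrA mulrA ler_pM ?normr_ge0 //.
  rewrite normr_nat ler_pdivlMr ?ltr0n ?fact_gt0 // -natrM -natrX ler_nat.
  apply: (@leq_trans ('C(y, n`!) * 2 ^ n`!)).
    by rewrite leq_mul2l (ltnW (ltn_expl _ _)) // orbT.
  apply: leq_trans (bin_mul_pow2_le y _) _.
  by rewrite leq_exp2l // Dx addnS -addSn leq_addl.
- rewrite hornerZ mulVf // mul1r big1 ?subrr ?normr0 // => k _.
  by rewrite mulr0 subr0.
Qed.

End PointApproximation.

(** * Orthogonal matrix polynomials *)

Section UnitCriterion.
Variables (K : fieldType) (m : nat).
Implicit Types A C : 'M[K]_m.+1.

Lemma unit_of_left_cancel A : (forall C, C * A = 0 -> C = 0) -> A \is a GRing.unit.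
Proof.
move=> A_inj; suff : A \in unitmx by []; rewrite -row_free_unit -kermx_eq0.
by apply/eqP/A_inj; exact: mulmx_ker.
Qed.

Lemma monic_left_cancel (p : {poly 'M[K]_m.+1}) C :
  p \is monic -> C%:P * p = 0 -> C = 0.
Proof.
move=> /monicP p_monic /(congr1 (fun q : {poly _} => q`_(size p).-1)).
by rewrite coefCM coef0 -/(lead_coef p) p_monic mulr1.
Qed.

End UnitCriterion.

Section OrthogonalPolynomials.
Variables (K : numClosedFieldType) (m : nat).
Local Notation N := m.+1.
Implicit Types (F G : nat -> 'M[K]_N) (p q r : {poly 'M[K]_N}).

Hypothesis K_summable : exp_summable K.
Variable V : nat -> 'M[K]_N.
Hypothesis V_bounded : exp_bounded V.
Hypothesis V_unit : forall x, V x \is a GRing.unit.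

Local Notation W := (gram_weight V).
Local Notation pairing := (pairing V).

Definition at_nat p (x : nat) : 'M[K]_N := p.[x%:R].

Variable P : nat -> {poly 'M[K]_N}.
Hypothesis P_monic : forall n, P n \is monic.
Hypothesis P_size : forall n, size (P n) = n.+1.
Hypothesis P_orth : forall n k, n != k -> pairing (at_nat (P n)) (at_nat (P k)) = 0.

Local Notation H n := (pairing (at_nat (P n)) (at_nat (P n))).

Lemma at_nat_bounded p : exp_bounded (at_nat p).
Proof. exact: exp_bounded_horner. Qed.
Hint Resolve at_nat_bounded : core.

Lemma at_natCM A p x : at_nat (A%:P * p) x = A * at_nat p x.
Proof. by rewrite /at_nat hornerCM. Qed.

(** Monic P_k, k < n, span the polynomials of degree below n over the matrix
ring: subtract a left multiple of the last one to lower the degree. *)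
Lemma pairing_poly_eq0 F n r : exp_bounded F ->
  (forall k, (k < n)%N -> pairing F (at_nat (P k)) = 0) -> (size r <= n)%N ->
  pairing F (at_nat r) = 0.
Proof.
move=> Fb; elim: n r => [|n IHn] r F0 r_size.
  have -> : at_nat r = fun x => 0 * at_nat r x.
    move: r_size; rewrite size_poly_leq0 => /eqP ->.
    by apply/funext => x; rewrite mul0r /at_nat horner0.
  by rewrite pairingMr // linear0 map_mx0 mulr0.
pose r' := r - (r`_n)%:P * P n.
have r'_size : (size r' <= n)%N.
  apply/leq_sizeP => j; rewrite leq_eqVlt => /orP[/eqP <-|lt_nj].
    rewrite coefB coefCM; have := monicP (P_monic n).
    by rewrite /lead_coef P_size /= => ->; rewrite mulr1 subrr.
  rewrite coefB coefCM (nth_default _ (leq_trans r_size lt_nj)).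
  by rewrite [X in _ * X]nth_default ?mulr0 ?subr0 ?P_size.
have -> : at_nat r = fun x => at_nat r' x + r`_n * at_nat (P n) x.
  by apply/funext => x; rewrite -at_natCM /at_nat -hornerD subrK.
rewrite pairingDr ?pairingMr ?F0 ?mul0r ?addr0 //; last first.
  by apply: exp_boundedM => //; exact: exp_bounded_cst.
by apply: IHn => // k /ltnW lt_k; exact: F0.
Qed.

Lemma pairing_orth_low n r : (size r <= n)%N -> pairing (at_nat (P n)) (at_nat r) = 0.
Proof.
by apply: pairing_poly_eq0 => // k lt_kn; apply: P_orth; rewrite gtn_eqF.
Qed.

Lemma sqnorm_unit n : H n \is a GRing.unit.
Proof.
apply: unit_of_left_cancel => C CH0; apply: (monic_left_cancel (P_monic n)).
apply: poly_eq0_of_nat => x _; rewrite -/(at_nat _ _) at_natCM.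
have b : exp_bounded (fun x => C * at_nat (P n) x).
  by apply: exp_boundedM => //; exact: exp_bounded_cst.
apply: (pairing_definite K_summable V_bounded V_unit b _ x).
by rewrite pairingMl // pairingMr // mulrA CH0 mul0r.
Qed.

(** The matrix analogue of the fact that zeros of orthogonal polynomials lie in the
interior of the convex hull of the support, here at the end point 0: divide
C P_n by X and pair it with the quotient. *)
Lemma orth_horner0_unit n : (P n).[0] \is a GRing.unit.
Proof.
apply: unit_of_left_cancel => C CP0; apply: (monic_left_cancel (P_monic n)).
have /factor_theorem [r Dr] : root (C%:P * P n) 0.
  by rewrite /root hornerCM CP0.
rewrite subr0 in Dr.
have r_size : (size r <= n)%N.
  have [->|r_nz] := eqVneq r 0; first by rewrite size_poly0.
  rewrite -ltnS -size_mulX // -Dr -[n.+1]P_size.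
  apply: leq_trans (size_polyMleq _ _) _.
  by rewrite size_polyC P_size; case: (C != 0) => /=.
suff r0 : r = 0 by rewrite Dr r0 mul0r.
have term0 : pairing_term V (at_nat (C%:P * P n)) (at_nat r) =
             fun x => x%:R *: pairing_term V (at_nat r) (at_nat r) x.
  apply/funext => x; rewrite Dr /pairing_term /at_nat hornerMX -!mulrA.
  by rewrite mulr_natl scaler_nat mulrnAr.
have sum0 : has_sum (pairing_term V (at_nat (C%:P * P n)) (at_nat r)) 0.
  have <- : pairing (at_nat (C%:P * P n)) (at_nat r) = 0.
    rewrite (_ : at_nat (_ * _) = fun x => C * at_nat (P n) x).
      by rewrite pairingMl // pairing_orth_low // mulr0.
    by apply/funext => x; rewrite at_natCM.
  exact: has_sum_pairing.
apply: poly_eq0_of_nat => x x_gt0; rewrite -/(at_nat r x).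
apply: (pairing_term_diag_eq0 V_unit) => i.
rewrite term0 in sum0.
have diag0 : (x%:R *: pairing_term V (at_nat r) (at_nat r) x) i i = 0.
  apply: (has_sum0_diag_eq0 sum0) => y.
  by rewrite mxE mulr_ge0 ?ler0n ?pairing_term_diag_ge0.
by move/eqP: diag0; rewrite mxE mulf_eq0 pnatr_eq0 gtn_eqF //= => /eqP.
Qed.

(** * Parseval identity for a point mass *)

Variable x0 : nat.

Definition point_mass (x : nat) : 'M[K]_N := (x == x0)%:R.

Lemma point_mass_bounded : exp_bounded point_mass.
Proof.
apply: (@exp_bounded_bounded _ _ _ 1) => x i j; rewrite /point_mass.
case: eqP => _; rewrite mxE ?normr0 ?ler01 //.
by case: eqP => _; rewrite ?normr1 ?normr0 ?ler01.
Qed.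
Hint Resolve point_mass_bounded : core.

Lemma pairing_point_mass F : exp_bounded F ->
  pairing point_mass F = W x0 * (F x0)^t*.
Proof.
move=> Fb; apply: (has_sum_unique (u := pairing_term V point_mass F)).
  exact: has_sum_pairing.
rewrite -[W x0]mul1r -[1]/(true%:R) -[in true%:R](eqxx x0).
apply: (has_sum_single (u := pairing_term V point_mass F)) => x /negPf x_neq.
by rewrite /pairing_term /point_mass x_neq !mul0r.
Qed.

(** The k-th term of the Christoffel-Darboux kernel on the diagonal at x0. *)
Definition kernel_term (k : nat) : 'M[K]_N :=
  (at_nat (P k) x0)^t* * (H k)^-1 * at_nat (P k) x0.

(** The Fourier coefficients <E, P_k> H_k^-1 of the point mass E at x0 are explicit
because E is concentrated at x0. *)
Definition projection (n : nat) : {poly 'M[K]_N} :=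
  \sum_(k < n) (W x0 * (at_nat (P k) x0)^t* * (H k)^-1)%:P * P k.

Definition residual n (x : nat) : 'M[K]_N := point_mass x - at_nat (projection n) x.

Lemma residual_bounded n : exp_bounded (residual n).
Proof. exact: exp_boundedB. Qed.
Hint Resolve residual_bounded : core.

Lemma size_projection n : (size (projection n) <= n)%N.
Proof.
apply/leq_sizeP => j le_nj; rewrite coef_sum big1 // => k _.
by rewrite coefCM nth_default ?mulr0 // P_size (leq_trans _ le_nj).
Qed.

Lemma pairing_projection n j : (j < n)%N ->
  pairing (at_nat (projection n)) (at_nat (P j)) = W x0 * (at_nat (P j) x0)^t*.
Proof.
have pairing_sum (c : nat -> 'M[K]_N) l G : exp_bounded G ->
    pairing (at_nat (\sum_(k < l) (c k)%:P * P k)) G =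
    \sum_(k < l) c k * pairing (at_nat (P k)) G.
  move=> Gb; elim: l => [|l IHl].
    rewrite !big_ord0 (_ : at_nat 0 = fun x => 0 * at_nat 0 x).
      by rewrite pairingMl // mul0r.
    by apply/funext => x; rewrite mul0r /at_nat horner0.
  rewrite !big_ord_recr /= -IHl -pairingMl // -pairingDl //; last first.
    by apply: exp_boundedM => //; exact: exp_bounded_cst.
  by congr pairing; apply/funext => x; rewrite -at_natCM /at_nat -hornerD.
move=> lt_jn.
rewrite (pairing_sum (fun k => W x0 * (at_nat (P k) x0)^t* * (H k)^-1)) //.
rewrite (bigD1 (Ordinal lt_jn)) //= divrK ?sqnorm_unit //.
by rewrite big1 ?addr0 // => k k_neq; rewrite [pairing _ (at_nat (P j))]P_orth ?mulr0.
Qed.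

Lemma residual_orth n r : (size r <= n)%N -> pairing (residual n) (at_nat r) = 0.
Proof.
apply: pairing_poly_eq0 => // k lt_kn.
by rewrite pairingBl // pairing_point_mass // pairing_projection // subrr.
Qed.

(** The residual R is orthogonal to the projection, so <R, R> = <R, E>, and pairing
with E evaluates R at x0. *)
Lemma pairing_residual n :
  pairing (residual n) (residual n) = W x0 - W x0 * series kernel_term n * W x0.
Proof.
rewrite [in X in pairing _ X]/residual pairingBr //.
rewrite residual_orth ?size_projection // subr0 -pairing_adj //.
rewrite pairing_point_mass // adjmxM trmxCK gram_weight_adj.
rewrite -[_ *m _]/(residual n x0 * W x0) /residual /point_mass eqxx mulrBl mul1r.
congr (_ - _ * _).
rewrite /at_nat /projection horner_sum /series /= big_mkord mulr_sumr.
by apply: eq_bigr => k _; rewrite hornerCM /kernel_term !mulrA.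
Qed.

(** E - q is the residual plus a polynomial of degree below n, to which the
residual is orthogonal. *)
Lemma residual_minimal n q : (size q <= n)%N ->
  \tr (pairing (residual n) (residual n)) <=
  \tr (pairing (fun x => point_mass x - at_nat q x)
               (fun x => point_mass x - at_nat q x)).
Proof.
move=> q_size; pose p := projection n - q.
have p_size : (size p <= n)%N.
  apply: leq_trans (size_polyD _ _) _.
  by rewrite geq_max size_projection size_polyN.
have -> : (fun x => point_mass x - at_nat q x) =
          fun x => residual n x + at_nat p x.
  apply/funext => x; rewrite /residual /at_nat hornerD hornerN.
  by rewrite addrA subrK.
rewrite pairing_pythagoras ?residual_orth // raddfD /= lerDl.
exact: pairing_trace_ge0.
Qed.

(** Compare with the approximants of [point_approx]: their squared error is at
most C^2 c^(2x) / n!^2, and the trace of the weight is at most B b^x / x!, so the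
sum over x is bounded by a convergent exponential series times 1 / n!. *)
Lemma approx_residual : exists2 L : K, 0 <= L & forall n, exists s, forall k,
  (s <= k)%N -> \tr (pairing (residual k) (residual k)) <= L / n`!%:R.
Proof.
have [C [c [C0 c0 approx]]] := point_approx K x0.
have [B [b [B0 b0 W_le]]] :=
  exp_bounded_trace (exp_boundedM V_bounded (exp_bounded_adj V_bounded)).
pose u x := C ^+ 2 * B * ((c ^+ 2 * b) ^+ x / x`!%:R).
have u_ge0 x : 0 <= u x.
  by rewrite /u !mulr_ge0 ?invr_ge0 ?ler0n ?exprn_ge0 ?mulr_ge0 ?exprn_ge0.
have u_cvg : cvgn (series u).
  apply: (K_summable (C := C ^+ 2 * B) (c := c ^+ 2 * b)) => [||x].
  - by rewrite mulr_ge0 ?exprn_ge0.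
  - by rewrite mulr_ge0 ?exprn_ge0.
  - by rewrite ger0_norm.
pose L := limn (series u).
have uL : series u @ \oo --> L by [].
exists L; first by apply: cvgn_ge0 uL _ => n; apply: sumr_ge0.
move=> n; have [q q_le] := approx n.
pose Q := map_poly (@scalar_mx K N) q; exists (size Q) => k le_k.
apply: le_trans (residual_minimal le_k) _.
pose F x := point_mass x - at_nat Q x.
have Fb : exp_bounded F by exact: exp_boundedB.
pose e := n`!%:R^-1 : K.
have e_ge0 : 0 <= e by rewrite invr_ge0 ler0n.
have e_le1 : e <= 1 by rewrite invf_le1 ?ltr0n ?ler1n fact_gt0.
have term_le x : \tr (pairing_term V F F x) <= u x * e.
  have FE : F x = ((x == x0)%:R - q.[x%:R])%:M.
    rewrite /F /point_mass /at_nat -!(rmorph_nat (@scalar_mx K N)).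
    by rewrite horner_map raddfB.
  rewrite /pairing_term FE; set s := _ - _.
  have -> : \tr (s%:M * W x * (s%:M)^t* ) =
            `|s| ^+ 2 * (x`!%:R^-1 * \tr (V x * (V x)^t* )).
    rewrite tr_scalar_mx map_scalar_mx /= -[_ * _ * _]/(s%:M *m _ *m _).
    by rewrite mul_scalar_mx mul_mx_scalar !linearZ /= normCK mulrA [_^* * _]mulrC.
  have trV_ge0 : 0 <= \tr (V x * (V x)^t* ).
    by apply: sumr_ge0 => i _; exact: gram_diag_ge0.
  have s2_le : `|s| ^+ 2 <= (C * c ^+ x) ^+ 2 * e.
    apply: (@le_trans _ _ ((C * c ^+ x * e) ^+ 2)).
      by rewrite lerXn2r ?nnegrE // ?mulr_ge0 ?exprn_ge0 //; exact: q_le.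
    rewrite exprMn ler_wpM2l ?exprn_ge0 ?mulr_ge0 ?exprn_ge0 //.
    by rewrite expr2 -[leRHS]mulr1 ler_wpM2l.
  have trW_le : x`!%:R^-1 * \tr (V x * (V x)^t* ) <= x`!%:R^-1 * (B * b ^+ x).
    by rewrite ler_wpM2l ?invr_ge0 ?ler0n // -(ger0_norm trV_ge0).
  apply: le_trans (ler_pM _ _ s2_le trW_le) _; rewrite ?exprn_ge0 //.
    by rewrite mulr_ge0 ?invr_ge0 ?ler0n.
  rewrite le_eqVlt; apply/orP; left; apply/eqP.
  rewrite /u exprMn [(c ^+ 2 * b) ^+ x]exprMn [c ^+ 2 ^+ x]exprAC.
  by ring.
have FF := has_sum_trace (has_sum_pairing K_summable V_bounded Fb Fb).
rewrite -subr_ge0.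
have D : (fun n => series u n * e -
    series (fun x => \tr (pairing_term V F F x)) n) @ \oo --> L * e - \tr (pairing F F).
  by apply: cvgB => //; apply: cvgMr_tmp.
apply: cvgn_ge0 D _ => l; rewrite subr_ge0 /series /= mulr_suml.
by apply: ler_sum => x _; exact: term_le.
Qed.

Lemma residual_cvg0 :
  (fun n => pairing (residual n) (residual n)) @ \oo --> (0 : 'M[K]_N).
Proof.
have [L L0 approx] := approx_residual.
have L_cvg0 : (fun n => L / n`!%:R) @ \oo --> (0 : K).
  (* These are the terms of the exponential series at 1. *)
  apply: (@cvg_series_cvg_0 _ K^o); apply: (K_summable (C := L) (c := 1)) => // n.
  by rewrite expr1n mul1r ger0_norm // mulr_ge0 ?invr_ge0 ?ler0n.
apply/cvg_mxP => i j; rewrite mxE.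
apply/cvgrPdist_lt => e e0.
have /cvgrPdist_lt/(_ e e0) [n _ /(_ n (leqnn n)) /=] := L_cvg0.
rewrite sub0r normrN ger0_norm ?mulr_ge0 ?invr_ge0 ?ler0n // => Ln_lt.
have [s s_le] := approx n; exists s => // k /= le_sk.
rewrite sub0r normrN; apply: le_lt_trans Ln_lt.
apply: le_trans (s_le _ le_sk); exact: pairing_norm_le_trace.
Qed.

(** Completeness of the polynomials at the point x0: <R_n, R_n> tends to 0, and the
partial sums are W^-1 - W^-1 <R_n, R_n> W^-1 with W the weight at x0. *)
Theorem kernel_has_sum : has_sum kernel_term (W x0)^-1.
Proof.
have W_unit := gram_weight_unit V_unit x0.
have := cvg_mx_mulr (C := (W x0)^-1) (cvg_mx_mull (C := (W x0)^-1) residual_cvg0).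
rewrite mulr0 mul0r => cvg0.
have D : (fun n => (W x0)^-1 -
    (W x0)^-1 * pairing (residual n) (residual n) * (W x0)^-1) @ \oo --> (W x0)^-1.
  by rewrite -[X in _ --> X]subr0; apply: cvgB => //; exact: cvg_cst.
apply: cvgn_ext D => n; rewrite pairing_residual mulrBr mulrBl mulVr // mul1r.
by rewrite opprB addrC subrK !mulrA mulVr // mul1r mulrK.
Qed.

End OrthogonalPolynomials.

(** * The matrix Charlier weight *)

Section CharlierWeight.
Variables (K : numClosedFieldType) (m : nat) (a : K) (mu : 'I_m.+1 -> K).
Variable lambda : nat.
Local Notation N := m.+1.
Local Notation A := (mxA mu).
Hypothesis a_gt0 : 0 < a.

Lemma trig_mx_unit (B : 'M[K]_N) :
  is_trig_mx B -> (forall i, B i i != 0) -> B \is a GRing.unit.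
Proof.
move=> B_trig B_diag; suff : B \in unitmx by [].
by rewrite unitmxE unitfE det_trig //; apply/prodf_neq0.
Qed.

Lemma one_add_mxA_unit : 1 + A \is a GRing.unit.
Proof.
apply: trig_mx_unit => [|i].
  apply/is_trig_mxP => i j lt_ij; rewrite !mxE -val_eqE (ltn_eqF lt_ij).
  by rewrite (ltn_eqF (leq_trans lt_ij _)) ?addr0 // leqnSn.
by rewrite !mxE eqxx (ltn_eqF (ltnSn i)) addr0 oner_eq0.
Qed.

(** J (1 + A^* ) + k is upper triangular with positive diagonal entries j + k,
j >= 1. *)
Lemma mxJ_one_add_mxA_unit k : mxJ K m * (1 + A^t* ) + k%:R \is a GRing.unit.
Proof.
rewrite -adjmx_unit.
have JE i j : ((mxJ K m * (1 + A^t* ) + k%:R)^t* ) i j =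
    j.+1%:R * ((i == j)%:R + A i j) + k%:R *+ (i == j).
  rewrite -(rmorph_nat (@scalar_mx K N)) -[mxJ K m * _]/(mxJ K m *m _) /mxJ mul_diag_mx.
  rewrite !mxE !(rmorphD, rmorphM) /= conjCK.
  by rewrite !conjC_nat rmorphMn /= conjC_nat [j == i]eq_sym.
apply: trig_mx_unit => [|i]; last first.
  by rewrite JE !mxE eqxx (ltn_eqF (ltnSn i)) addr0 mulr1 -natrD pnatr_eq0.
apply/is_trig_mxP => i j lt_ij; rewrite JE !mxE -val_eqE (ltn_eqF lt_ij).
by rewrite (ltn_eqF (leq_trans lt_ij _)) ?addr0 ?mulr0 // leqnSn.
Qed.

Lemma Upsilon_unit i x : (i = Dual3 -> (0 < lambda)%N) ->
  Upsilon a mu lambda i x \is a GRing.unit.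
Proof.
have A_unit := one_add_mxA_unit.
have a_unit k : a ^+ k != 0 by rewrite expf_neq0 // gt_eqF.
have c_unit : (- 2) ^+ x / a ^+ x != 0.
  by rewrite mulf_neq0 ?invr_eq0 // expf_neq0 // oppr_eq0 pnatr_eq0.
have prod_unit k B : (B = mxJ K m * (1 + A^t* ) + k%:R) ->
    (1 + A) ^+ lambda * B ^- x * (1 + A) ^- (x + lambda) \is a GRing.unit.
  by move=> ->; rewrite !unitrMl ?unitrV ?unitrX // mxJ_one_add_mxA_unit.
case: i => [_|_|/(_ erefl) lambda_gt0] /=; rewrite scaler_unit ?unitfE ?invr_eq0 //.
- by rewrite unitrV unitrX.
- exact: prod_unit.
(* lambda - 1 is a natural number in this case. *)
- by apply: (prod_unit lambda.-1); rewrite -subn1 natrB.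
Qed.

Lemma delta_ge0 k : 0 <= delta a lambda (m := m) k.
Proof. by rewrite /delta !mulr_ge0 ?exprn_ge0 ?mulr_ge0 ?invr_ge0 ?ler0n // ltW. Qed.

Lemma delta_neq0 k : delta a lambda (m := m) k != 0.
Proof.
rewrite /delta !mulf_neq0 ?expf_neq0 ?mulf_neq0 ?invr_eq0 ?pnatr_eq0 //.
- by rewrite gt_eqF.
- by rewrite -lt0n fact_gt0.
- by rewrite -lt0n fact_gt0.
Qed.

Definition weight_root (x : nat) : 'M[K]_N :=
  sqrtC a ^+ x *: ((1 + A) ^+ (x + lambda) *
                   diag_mx (\row_k sqrtC (delta a lambda k))).

Lemma weight_gram : weight a mu lambda = gram_weight weight_root.
Proof.
have sqrt_norm (c : K) : 0 <= c -> sqrtC c * (sqrtC c)^* = c.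
  by move=> c0; rewrite geC0_conj ?sqrtC_ge0 // -expr2 sqrtCK.
apply/funext => x; rewrite /weight /gram_weight /weight_root.
set S := diag_mx _.
have TE : mxT m a lambda = S * S^t*.
  rewrite -[S * _]/(S *m _) tr_diag_mx map_diag_mx mulmx_diag; congr diag_mx.
  by apply/rowP => k; rewrite !mxE sqrt_norm // delta_ge0.
rewrite adjmxZ adjmxM adjmxX adjmxD trmx1 map_mx1.
rewrite -scalerAl -scalerAr !scalerA rmorphXn /=.
have -> : x`!%:R^-1 * sqrtC a ^+ x * (sqrtC a)^* ^+ x = a ^+ x / x`!%:R.
  by rewrite -mulrA -exprMn sqrt_norm ?(ltW a_gt0) // mulrC.
by rewrite TE -[S^t* *m _]/(S^t* * _) !mulrA.
Qed.

Lemma weight_root_bounded : exp_bounded weight_root.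
Proof.
have -> : weight_root = fun x => (sqrtC a)%:M ^+ x *
    ((1 + A) ^+ x * ((1 + A) ^+ lambda * diag_mx (\row_k sqrtC (delta a lambda k)))).
  apply/funext => x; rewrite /weight_root exprD !mulrA -rmorphXn /= -!mulrA.
  by rewrite -[RHS]/(_ *m _) mul_scalar_mx.
do 2![apply: exp_boundedM; first exact: exp_boundedX].
exact: exp_bounded_cst.
Qed.

Lemma weight_root_unit x : weight_root x \is a GRing.unit.
Proof.
rewrite scaler_unit ?unitfE ?expf_neq0 ?sqrtC_eq0 ?gt_eqF //.
rewrite unitrMr; last by rewrite unitrX // one_add_mxA_unit.
apply: trig_mx_unit; first exact: diag_mx_is_trig.
by move=> i; rewrite !mxE eqxx mulr1n sqrtC_eq0 delta_neq0.
Qed.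

End CharlierWeight.

(** * The norms of the dual polynomials *)

Theorem dual_norm_has_sum (K : numClosedFieldType) (m : nat) (a : K)
    (mu : 'I_m.+1 -> K) (lambda : nat) (P : nat -> {poly 'M[K]_m.+1})
    (i : dual_family) (x : nat) (Q : {poly 'M[K]_m.+1}) :
  exp_summable K -> 0 < a -> monic_orthogonal a mu lambda P ->
  (i = Dual3 -> (0 < lambda)%N) -> is_dual_poly a mu lambda P i x Q ->
  has_sum (dual_norm_term a mu lambda P i Q)
    (Upsilon a mu lambda i x * weight a mu lambda x
       * (Upsilon a mu lambda i x)^t* )^-1.
Proof.
move=> K_summable a_gt0 [P_monic_size P_orth] lambda_gt0 [_ _ Q_dual].
pose V := weight_root a mu lambda.
have Vb : exp_bounded V by exact: weight_root_bounded.
have Vu y : V y \is a GRing.unit by exact: weight_root_unit.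
have innerE p q : inner a mu lambda p q = pairing V (at_nat p) (at_nat q).
  by rewrite /inner weight_gram.
have P_monic n : P n \is monic by case: (P_monic_size n).
have P_size n : size (P n) = n.+1 by case: (P_monic_size n).
have P_orthV n k : n != k -> pairing V (at_nat (P n)) (at_nat (P k)) = 0.
  by move=> /P_orth; rewrite innerE.
have P0_unit n : (P n).[0] \is a GRing.unit.
  exact: (orth_horner0_unit K_summable Vb Vu P_monic P_size P_orthV).
set U := Upsilon _ _ _ _ _; have U_unit : U \is a GRing.unit by exact: Upsilon_unit.
have W_unit := gram_weight_unit Vu x.
(* P_n(0) cancels between Q and the dual weight. *)
have termE n : dual_norm_term a mu lambda P i Q n =
    (U^-1)^t* * kernel_term V P x n * U^-1.
  have pQ : (P n).[0] * lhorner Q (rho a mu lambda P i n) = at_nat (P n) x * U^-1.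
    by rewrite Q_dual !mulrA mulrV // mul1r.
  rewrite /dual_norm_term /dual_weight /sqnorm innerE.
  rewrite -!mulrA pQ !mulrA -[X in X * _ * _ * _]adjmxM.
  by rewrite -[_ *m lhorner _ _]/(_ * lhorner _ _) pQ adjmxM.
have kernel_sum : has_sum (kernel_term V P x) (gram_weight V x)^-1.
  exact: kernel_has_sum.
rewrite weight_gram // -/V !invrM ?unitrMr ?adjmx_unit // -adjmxV mulrA.
have := has_sum_mulr (C := U^-1) (has_sum_mull (C := (U^-1)^t* ) kernel_sum).
by apply: cvgn_ext => n; apply: eq_bigr => k _; rewrite termE.
Qed.

Theorem proposition8p15 (R : realType) (m : nat) (a : R[i])
  (mu : 'I_m.+1 -> R[i]) (lambda : nat)
  (P : nat -> {poly 'M[R[i]]_m.+1})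
  (a_gt0 : 0 < a) (mu_gt0 : forall k, 0 < mu k) (mu_rel : mu_relation a mu)
  (P_orth : monic_orthogonal a mu lambda P)
  (i : dual_family) (lambda_gt0 : i = Dual3 -> (0 < lambda)%N)
  (x : nat) (Q : {poly 'M[R[i]]_m.+1})
  (Q_dual : is_dual_poly a mu lambda P i x Q) :
  has_sum (dual_norm_term a mu lambda P i Q)
    (Upsilon a mu lambda i x * weight a mu lambda x
       * (Upsilon a mu lambda i x)^t* )^-1.
Proof. by apply: dual_norm_has_sum => //; exact: complex_exp_summable. Qed.
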